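(* Let $X$ and $Y$ be real Hilbert spaces, $A\in\mathcal L(X,Y)$, $b\in Y$, and $K_r\subset X$ a bounded closed convex set containing $0$. For $\varepsilon\ge0$ let $$\pi_\varepsilon=\inf_{x\in X}\ \tfrac12 j_{K_r}^2(x)+\delta_{\overline{B(b,\varepsilon)}}(Ax)\in[0,+\infty],\qquad J_\varepsilon(y)=\tfrac12\sigma_{K_r}^2(A^*y)-\langle b,y\rangle_Y+\varepsilon\|y\|_Y\quad(y\in Y).$$ Then for any $\varepsilon\ge0$ strong duality holds: $$\pi_\varepsilon=-\inf_{y\in Y}J_\varepsilon(y).$$ Furthermore, if $\pi_\varepsilon$ is finite, then the infimum defining it is attained.
   Context: $\mathcal L(X,Y)$ is the space of bounded linear operators; $A^*\in\mathcal L(Y,X)$ is the Hilbert adjoint. $\sigma_{K_r}(x)=\sup_{v\in K_r}\langle x,v\rangle_X$ is the support function and $j_{K_r}(x)=\inf\{\alpha>0:x\in\alpha K_r\}\in[0,+\infty]$ the gauge function of $K_r$. $\overline{B(b,\varepsilon)}=\{z\in Y:\|z-b\|_Y\le\varepsilon\}$ (equal to $\{b\}$ if $\varepsilon=0$), and $\delta_C$ is the indicator function of $C$: $0$ on $C$, $+\infty$ elsewhere. *)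

(* Defs.v *)
From HB Require Import structures.
From mathcomp Require Import all_boot all_order all_algebra.
From mathcomp Require Import all_classical all_reals all_analysis.

Set Implicit Arguments.
Unset Strict Implicit.
Unset Printing Implicit Defensive.

Import Order.TTheory GRing.Theory Num.Theory.
Import numFieldNormedType.Exports.

Local Open Scope classical_set_scope.
Local Open Scope ring_scope.

(* [{dot V for idfun}] is the type of symmetric, bilinear, positive definite
   forms on [V]; the second field says that the form induces the norm of [V],
   for which [V] is complete. *)
HB.mixin Record CompleteNormedModule_isHilbert (R : realType) V
    of CompleteNormedModule R V := {
  inner : {dot V for (idfun : R -> R)} ;
  inner_normE : forall x : V, inner x x = `|x| ^+ 2 }.

#[short(type="hilbertType")]
HB.structure Definition Hilbert (R : realType) :=
  { V of CompleteNormedModule R V & CompleteNormedModule_isHilbert R V }.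

(* By the Riesz representation theorem, the set below is a singleton as soon as [A] is
   linear and bounded, so the default value [0] of [xget] is then irrelevant. *)
Definition adjoint (R : realType) (X Y : hilbertType R) (A : X -> Y) (y : Y)
    : X :=
  xget 0 [set z : X | forall x : X, inner (A x) y = inner x z].

Definition bounded_operator (R : realType) (X Y : hilbertType R) (A : X -> Y) :=
  exists M : R, forall x : X, `|A x| <= M * `|x|.

Local Open Scope ereal_scope.

Definition support_function (R : realType) (X : hilbertType R) (K : set X)
    (x : X) : \bar R :=
  ereal_sup [set (inner x v)%:E | v in K].

(* [ereal_inf set0 = +oo], hence the value +oo outside the cone spanned by K. *)
Definition minkowski_gauge (R : realType) (X : hilbertType R) (K : set X)
    (x : X) : \bar R :=
  ereal_inf [set a%:E | a in
    [set a : R | (0 < a)%R /\ [set (a *: v)%R | v in K] x]].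

Definition indicator (R : realType) (T : Type) (C : set T) (z : T) : \bar R :=
  if z \in C then 0 else +oo.

(* [closed_ball_ normr b e] is {z | |b - z| <= e}; [closed_ball b e] is the
   closure of the open ball, which is empty for e = 0. *)
Definition primal_objective (R : realType) (X Y : hilbertType R) (A : X -> Y)
    (b : Y) (K : set X) (eps : R) (x : X) : \bar R :=
  (2^-1)%:E * minkowski_gauge K x ^+ 2
  + indicator R (closed_ball_ (@Num.norm R Y) b eps) (A x).

Definition primal_value (R : realType) (X Y : hilbertType R) (A : X -> Y)
    (b : Y) (K : set X) (eps : R) : \bar R :=
  ereal_inf (range (primal_objective A b K eps)).

Definition dual_objective (R : realType) (X Y : hilbertType R) (A : X -> Y)
    (b : Y) (K : set X) (eps : R) (y : Y) : \bar R :=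
  (2^-1)%:E * support_function K (adjoint A y) ^+ 2
  - (inner b y)%:E + (eps * `|y|)%:E.

(* Main.v *)
Require Import Defs.
From HB Require Import structures.
From mathcomp Require Import all_boot all_order all_algebra.
From mathcomp Require Import all_classical all_reals all_analysis.
From mathcomp Require Import ring lra.

(** For [r > 0] call [x] r-feasible when [x] lies in [r K] and [A x] lies in the
closed ball of radius [eps] around [b]. The primal objective is at most [r^2/2]
at every r-feasible point, and a point where it is below [r^2/2] is r-feasible,
so the primal value is the infimum of [r^2/2] over the [r] for which r-feasible
points exist. Duality then becomes a statement about one [r] at a time.

- Weak duality: if [x] is r-feasible, then
  [<b,y> - eps |y| <= <A x,y> = <x,A* y> <= r sigma(A* y)], and
  [r sigma <= r^2/2 + sigma^2/2], whence [- J(y) <= r^2/2] for the dual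
  objective [J].

- Dual ascent: if no point is r-feasible, let [x] minimise [|b - A x|] over
  [r K] and put [u = b - A x], so that [|u| > eps]. The variational inequality
  at the minimiser says that [u] separates [A (r K)] from the ball, namely
  [r sigma(A* u) + d <= <b,u> - eps |u|] with [d = |u| (|u| - eps) > 0]. A
  suitable positive multiple [y] of [u] then satisfies [- J(y) >= r^2/2].

Hence r-feasible points exist as soon as [r^2/2] exceeds the dual value, which
closes the duality gap.

Both existence claims, that of the minimiser of [|b - A x|] and that of a primal
solution, ask for a common point of a decreasing family of nonempty closed
convex bounded sets. In a Hilbert space such a point exists
([nested_convex_nonempty]): the parallelogram law makes almost norm-minimal
points a Cauchy filter, so that weak compactness can be bypassed. The same
lemma yields the Riesz representation theorem, hence the adjoint of [A]. *)

Set Implicit Arguments.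
Unset Strict Implicit.
Unset Printing Implicit Defensive.

Import Order.TTheory GRing.Theory Num.Theory.
Import numFieldNormedType.Exports.

Local Open Scope classical_set_scope.
Local Open Scope ring_scope.

(** * Inner products *)

Section inner_product.
Context {R : realType} {X : hilbertType R}.
Implicit Types x y z : X.

Lemma innerC x y : inner x y = inner y x.
Proof. by rewrite hermC /= expr0 mul1r. Qed.

Lemma innerDl x y z : inner (x + y) z = inner x z + inner y z.
Proof. exact: linearDl. Qed.

Lemma innerZl (a : R) x z : inner (a *: x) z = a * inner x z.
Proof. exact: linearZl_LR. Qed.

Lemma innerNl x z : inner (- x) z = - inner x z.
Proof. by rewrite -scaleN1r innerZl mulN1r. Qed.

Lemma innerDr x y z : inner z (x + y) = inner z x + inner z y.
Proof. by rewrite innerC innerDl !(innerC z). Qed.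

Lemma innerZr (a : R) x z : inner z (a *: x) = a * inner z x.
Proof. by rewrite innerC innerZl (innerC z). Qed.

Lemma innerNr x z : inner z (- x) = - inner z x.
Proof. by rewrite innerC innerNl (innerC z). Qed.

Lemma inner0l x : inner 0 x = 0.
Proof. exact: linear0l. Qed.

Lemma inner0r x : inner x 0 = 0.
Proof. by rewrite innerC inner0l. Qed.

Definition innerE := (innerDl, innerDr, innerZl, innerZr, innerNl, innerNr).

(** Cauchy-Schwarz, from the nonnegativity of the squared norm of
[|y| x - |x| y]. *)
Lemma inner_le_norm x y : inner x y <= `|x| * `|y|.
Proof.
have [->|x0] := eqVneq x 0; first by rewrite inner0l mulr_ge0.
have [->|y0] := eqVneq y 0; first by rewrite inner0r mulr_ge0.
have xy : 0 < `|x| * `|y| by rewrite mulr_gt0 ?normr_gt0.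
have : 0 <= `| `|y| *: x - `|x| *: y| ^+ 2 by exact: sqr_ge0.
rewrite -inner_normE !innerE !inner_normE (innerC y x) => h.
rewrite -(ler_pM2l xy); nra.
Qed.

Lemma normr_inner_le x y : `|inner x y| <= `|x| * `|y|.
Proof. by rewrite ler_norml lerNl -innerNl -{1}(normrN x) !inner_le_norm. Qed.

Lemma parallelogram_law x y :
  `|x - y| ^+ 2 = 2 * `|x| ^+ 2 + 2 * `|y| ^+ 2 - 4 * `|2^-1 *: (x + y)| ^+ 2.
Proof. rewrite -!inner_normE !innerE (innerC y x); lra. Qed.

End inner_product.

(** * Convex sets and bounded linear maps *)

Lemma convex_setP {R : realType} {V : lmodType R} (C : set V) :
  convex_set (C : set (convex_lmodType V)) <->
  forall x y (t : R), 0 <= t <= 1 -> C x -> C y -> C (t *: x + (1 - t) *: y).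
Proof.
split=> [cC x y t /andP[t0 t1] Cx Cy|cC x y t /set_mem Cx /set_mem Cy].
  exact/set_mem/(cC x y (Itv01 t0 t1) (mem_set Cx) (mem_set Cy)).
by apply/mem_set/cC => //; apply/andP.
Qed.

Lemma linear_norm_bound_continuous {R : realType} {V W : normedModType R}
    (f : {linear V -> W}) (M : R) :
  (forall x, `|f x| <= M * `|x|) -> continuous f.
Proof.
move=> fM; apply/linear_bounded_continuous.
rewrite /bounded_near; near=> N; near=> x => /=.
apply: (le_trans (fM x)).
have x1 : `|x| <= 1.
  near: x; apply/nbhs_ballP; exists 1 => //= z.
  rewrite -ball_normE /= sub0r normrN.
  exact: ltW.
apply: (@le_trans _ _ `|M|).
  by rewrite (le_trans (ler_norm _))// normrM normr_id ler_piMr.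
by near: N; exact: nbhs_pinfty_ge.
Unshelve. all: by end_near. Qed.

(** * Nested convex sets and minimisers *)

(** The midpoint of [x] and [y] stays in [E], so its squared norm is at least
[a]; the parallelogram law turns this into a bound on the distance. *)
Lemma convex_sqr_dist {R : realType} {X : hilbertType R} (E : set X) (x y : X)
    (a b : R) : convex_set (E : set (convex_lmodType X)) ->
  (forall z, E z -> a <= `|z| ^+ 2) ->
  E x -> `|x| ^+ 2 <= b -> E y -> `|y| ^+ 2 <= b ->
  `|x - y| ^+ 2 <= 4 * (b - a).
Proof.
move=> /convex_setP cE aE Ex xb Ey yb.
have : E (2^-1 *: (x + y)).
  have := cE x y 2^-1; rewrite (_ : 1 - 2^-1 = 2^-1 :> R); last by field.
  by rewrite scalerDr; apply => //; apply/andP; split; lra.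
by move=> /aE; rewrite parallelogram_law; lra.
Qed.

(** Replaces weak compactness. Let [d] be the supremum over [t] of the minimal
squared norm on [E t]. The slices of the [E t] where the squared norm is at most
[d + t] are nonempty, and by [convex_sqr_dist] their diameters tend to 0, so
they generate a Cauchy filter whose limit lies in every closed [E t]. *)
Lemma nested_convex_nonempty {R : realType} {X : hilbertType R} (E : R -> set X)
    (M : R) :
  (forall t, 0 < t -> convex_set (E t : set (convex_lmodType X))) ->
  (forall t, 0 < t -> closed (E t)) ->
  (forall t, 0 < t -> E t !=set0) ->
  (forall s t, 0 < s -> s <= t -> E s `<=` E t) ->
  (forall x, E 1 x -> `|x| <= M) ->
  exists x, forall t, 0 < t -> E t x.
Proof.
move=> Ecvx Ecl En0 Emon EM.
(* Pooling the lower bounds over all [t] makes [d] a single supremum: for [h > 0]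
   every [E t] has a point of squared norm below [d + h], while some [E t] has
   none of squared norm at most [d - h]. *)
pose L := [set r | exists2 t : R, 0 < t & forall x, E t x -> r <= `|x| ^+ 2].
have L0 : L !=set0 by exists 0; exists 1 => // x _; exact: sqr_ge0.
have Lsup : has_sup L.
  split=> //; exists (M ^+ 2) => r [t t0 tr].
  have m0 : 0 < Num.min t 1 by rewrite lt_min t0 ltr01.
  have [x Ex] := En0 _ m0.
  apply: (le_trans (tr x (Emon _ _ m0 _ _ Ex))); first by rewrite ge_min lexx.
  have xM : `|x| <= M.
    by apply/EM/(Emon _ _ m0 _ _ Ex); rewrite ge_min lexx orbT.
  by rewrite ler_sqr ?nnegrE //; exact: le_trans xM.
set d := sup L.
pose G t := E t `&` [set x | `|x| ^+ 2 <= d + t].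
have Gn0 t : 0 < t -> G t !=set0.
  move=> t0; apply: contrapT => nG.
  have : d + t <= d.
    apply: (ub_le_sup Lsup.2); exists t => // x Ex.
    rewrite leNgt; apply/negP => xd; apply: nG.
    by exists x; split=> //; exact: ltW.
  by rewrite gerDl leNgt t0.
have Gmon s t : 0 < s -> s <= t -> G s `<=` G t.
  move=> s0 st x [Ex xs]; split; first exact: Emon Ex.
  by apply: (le_trans xs); rewrite lerD2l.
pose F := filter_from [set t : R | 0 < t] G.
have FF : ProperFilter F.
  apply: filter_from_proper => //; apply: filter_from_filter.
    by exists 1 => /=.
  move=> s t /= s0 t0; have m0 : 0 < Num.min s t by rewrite lt_min s0.
  exists (Num.min s t) => // x Gx.
  by split; apply: Gmon Gx; rewrite // ge_min lexx ?orbT.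
have Fcauchy : cauchy F.
  apply: cauchy_exP => e e0.
  (* With [e^2/16] for both slacks, the squared diameter is at most [e^2/2]. *)
  have h0 : 0 < e ^+ 2 / 16 by rewrite divr_gt0 ?exprn_gt0.
  have [r [t t0 tr] dr] := sup_adherent h0 Lsup.
  have s0 : 0 < Num.min t (e ^+ 2 / 16) by rewrite lt_min t0.
  set s := Num.min t _ in s0.
  have [st sh] : s <= t /\ s <= e ^+ 2 / 16 by rewrite !ge_min !lexx orbT.
  have [x [Ex xs]] := Gn0 _ s0.
  exists x; exists s => // y [Ey ys]; rewrite -ball_normE /=.
  have bnd := convex_sqr_dist (Ecvx _ t0) tr (Emon _ _ s0 st _ Ex) xs
    (Emon _ _ s0 st _ Ey) ys.
  rewrite -ltr_sqr ?nnegrE ?(ltW e0) //; apply: (le_lt_trans bnd).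
  by rewrite -/d in dr; lra.
have Fl := cauchy_cvg F Fcauchy.
exists (lim F) => t t0; apply: (Ecl _ t0) => B /Fl[s s0 GB].
have m0 : 0 < Num.min s t by rewrite lt_min s0.
have [x Gx] := Gn0 _ m0; exists x; split.
  by apply: (Emon _ _ m0 _ _ Gx.1); rewrite ge_min lexx orbT.
by apply: GB; apply: Gmon Gx => //; rewrite ge_min lexx.
Qed.

Section affine_sublevel.
Context {R : realType} {X : hilbertType R} {Y : normedModType R}.
Variables (A : {linear X -> Y}) (b : Y).

Lemma convex_sublevel (C : set X) (r : R) :
  convex_set (C : set (convex_lmodType X)) ->
  convex_set ((C `&` [set x | `|b - A x| <= r]) : set (convex_lmodType X)).
Proof.
move=> /convex_setP cC.
apply/convex_setP => x y t /andP[t0 t1] [Cx /= xr] [Cy /= yr].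
split; first by apply: cC => //; rewrite t0.
have -> : b - A (t *: x + (1 - t) *: y) = t *: (b - A x) + (1 - t) *: (b - A y).
  rewrite linearD !linearZ /= !scalerBr addrACA -scalerDl -opprD.
  by rewrite (addrC t) subrK scale1r.
apply: (le_trans (ler_normD _ _)); rewrite !normrZ (ger0_norm t0).
by rewrite ger0_norm ?subr_ge0 //; nra.
Qed.

Lemma closed_sublevel (C : set X) (r : R) : continuous A -> closed C ->
  closed (C `&` [set x | `|b - A x| <= r]).
Proof.
move=> cA Ccl; apply: closedI => //.
rewrite (_ : [set x | _] = (fun x => `|b - A x|) @^-1` [set u | u <= r])//.
apply: closed_comp; last exact: closed_le.
move=> x _; apply: cvg_norm; apply: cvgB; [exact: cvg_cst|exact: cA].
Qed.

(** A minimiser is a common point of the nested sets where the distance exceeds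
its infimum by at most [t]. Only the sublevel sets need be bounded, which leaves
room for the unbounded hyperplane of the Riesz theorem. *)
Lemma min_dist_attained (C : set X) : continuous A ->
  convex_set (C : set (convex_lmodType X)) -> closed C -> C !=set0 ->
  (forall r, exists M, forall x, C x -> `|b - A x| <= r -> `|x| <= M) ->
  exists2 x, C x & forall z, C z -> `|b - A x| <= `|b - A z|.
Proof.
move=> cA cC Ccl [c0 Cc0] Cbnd.
pose D := [set `|b - A x| | x in C].
have Dinf : has_inf D.
  by split; [exists `|b - A c0|; exists c0|exists 0 => _ [x _ <-]].
have [M hM] := Cbnd (inf D + 1).
have [|||||x xE] := @nested_convex_nonempty _ _
    (fun t => C `&` [set x | `|b - A x| <= inf D + t]) M.
- by move=> t _; exact: convex_sublevel.
- by move=> t _; exact: closed_sublevel.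
- move=> t t0; have [_ [x Cx <-] xt] := inf_adherent t0 Dinf.
  by exists x; split=> //; exact: ltW.
- move=> s t _ st x [Cx /= xs]; split=> //=.
  by apply: (le_trans xs); rewrite lerD2l.
- by move=> x [Cx xr]; exact: hM.
exists x; first by have [] := xE 1 ltr01.
move=> z Cz; apply: (@le_trans _ _ (inf D)).
  by apply/ler_addgt0Pr => e e0; have [] := xE e e0.
by apply: (ge_inf Dinf.2); exists z.
Qed.

End affine_sublevel.

(** Variational inequality: with [u = b - A x] and [v = A z - A x], moving from
[x] towards [z] by a fraction [s] gives [|u|^2 <= |u - s v|^2] for all [s] in
[[0, 1]], which forces [<v, u> <= 0]. *)
Lemma min_dist_obtuse {R : realType} {X : lmodType R} {Y : hilbertType R}
    (A : {linear X -> Y}) (b : Y) (C : set X) (x z : X) :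
  convex_set (C : set (convex_lmodType X)) -> C x -> C z ->
  (forall w, C w -> `|b - A x| <= `|b - A w|) ->
  inner (A z - A x) (b - A x) <= 0.
Proof.
move=> /convex_setP cC Cx Cz xmin.
set v := A z - A x; set u := b - A x.
have segment s : b - A (s *: z + (1 - s) *: x) = u - s *: v.
  rewrite (_ : s *: z + (1 - s) *: x = x + s *: (z - x)); last first.
    by rewrite scalerBl scale1r scalerBr addrCA addrA addrC.
  by rewrite linearD linearZ linearB /= opprD addrA.
rewrite leNgt; apply/negP => p0; set p := inner v u in p0.
have q0 : 0 <= `|v| ^+ 2 by exact: sqr_ge0.
(* This [t] lies in ]0, 1] and has [t |v|^2 <= p], while minimality would need
   [2 p <= t |v|^2]. *)
set t := p / (p + `|v| ^+ 2).
have pq : 0 < p + `|v| ^+ 2 by rewrite ltr_pwDl.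
have t0 : 0 < t by rewrite divr_gt0.
have t1 : t <= 1 by rewrite ler_pdivrMr // mul1r lerDl.
have tE : t * (p + `|v| ^+ 2) = p by rewrite divfK ?gt_eqF.
have := xmin _ (cC z x t _ Cz Cx); rewrite (ltW t0) t1 => /(_ isT).
rewrite -/u segment; clearbody u v.
rewrite -ler_sqr ?nnegrE // -!inner_normE !innerE.
rewrite !(inner_normE u) (inner_normE v) (innerC u v) -/p => h.
suff : t * p > 0 by nra.
exact: mulr_gt0.
Qed.

(** * The adjoint *)

(** The point [z] of least norm on the hyperplane [f = 1] is orthogonal to the
kernel of [f], so [z / |z|^2] represents [f]. *)
Lemma riesz_representation {R : realType} {X : hilbertType R}
    (f : {linear X -> R^o}) (M : R) :
  (forall x, `|f x| <= M * `|x|) -> exists z, forall x, f x = inner x z.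
Proof.
move=> fM; have fcont := linear_norm_bound_continuous fM.
have [f0|/existsNP[x1 fx1]] := pselect (forall x, f x = 0).
  by exists 0 => x; rewrite f0 inner0r.
pose C := [set x | f x = 1].
have Ccvx : convex_set (C : set (convex_lmodType X)).
  apply/convex_setP => x y t _ /= fx fy; rewrite /C/= linearD !linearZ /= fx fy.
  by rewrite /GRing.scale /= !mulr1 addrC subrK.
have Ccl : closed C.
  rewrite (_ : C = f @^-1` [set 1])//; apply: closed_comp.
    by move=> x _; exact: fcont.
  exact: closed_eq.
have Cn0 : C !=set0.
  exists ((f x1)^-1 *: x1); rewrite /C/= linearZ /= /GRing.scale /= mulVf //.
  exact/eqP.
have [|z Cz zmin] :=
  @min_dist_attained _ _ X idfun 0 C (fun _ _ => id) Ccvx Ccl Cn0.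
  by move=> r; exists r => x _; rewrite sub0r normrN.
have orth h : f h = 0 -> inner h z = 0.
  have le0 k : f k = 0 -> 0 <= inner k z.
    move=> fk; have Czk : C (z + k) by rewrite /C /= linearD /= fk addr0.
    have := min_dist_obtuse Ccvx Cz Czk zmin.
    by rewrite /= addrC addKr sub0r innerNr oppr_le0.
  move=> fh; apply/eqP; rewrite eq_le le0 // andbT -oppr_ge0 -innerNl.
  by apply: le0; rewrite linearN /= fh oppr0.
have z0 : `|z| ^+ 2 != 0.
  rewrite sqrf_eq0 normr_eq0; apply/eqP => z0; move: Cz.
  by rewrite /C/= z0 linear0 => /eqP; rewrite eq_sym oner_eq0.
exists ((`|z| ^+ 2)^-1 *: z) => x.
have := orth (x - f x *: z).
rewrite linearB linearZ /= Cz /GRing.scale /= mulr1 subrr => /(_ erefl)/eqP.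
rewrite innerDl innerNl innerZl inner_normE subr_eq0 => /eqP xz.
by rewrite innerZr xz mulrCA mulVf // mulr1.
Qed.

Lemma adjointP {R : realType} {X Y : hilbertType R} (A : {linear X -> Y})
    (x : X) (y : Y) :
  bounded_operator A -> inner (A x) y = inner x (adjoint A y).
Proof.
move=> [M AM]; rewrite /adjoint; case: xgetP => [z _ ->//|nz].
pose f (x : X) : R^o := inner (A x) y.
have fM u : `|f u| <= M * `|y| * `|u|.
  by rewrite (le_trans (normr_inner_le _ _)) // mulrAC ler_wpM2r.
have flin : linear f by move=> a u v; rewrite /f linearP innerDl innerZl.
pose F : {linear X -> R^o} :=
  HB.pack f (GRing.isLinear.Build R X R^o *:%R f flin).
have [z zP] := @riesz_representation _ _ F _ fM.
by case: (nz z).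
Qed.

(** * Duality *)

(** Presents the support function as the real least upper bound [s], so that the
dual objective can be handled with real arithmetic. *)
Lemma support_functionP {R : realType} {X : hilbertType R} (K : set X) (x : X) :
  bounded_set K -> K 0 ->
  exists s : R, [/\ support_function K x = s%:E, 0 <= s,
    forall v, K v -> inner x v <= s
  & forall c, (forall v, K v -> inner x v <= c) -> s <= c].
Proof.
move=> /pinfty_ex_gt0[M M0 KM] K0.
have ub0 : (0 <= support_function K x)%E.
  by apply: ereal_sup_ubound; exists 0 => //; rewrite inner0r.
have ubM : (support_function K x <= (`|x| * M)%:E)%E.
  apply: ge_ereal_sup => _ [v Kv <-]; rewrite lee_fin.
  by apply: (le_trans (inner_le_norm _ _)); rewrite ler_wpM2l //; exact: KM.
have fin : support_function K x \is a fin_num.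
  by rewrite ge0_fin_numE //; exact: le_lt_trans ubM (ltry _).
exists (fine (support_function K x)).
split; first by rewrite fineK.
- exact: fine_ge0.
- by move=> v Kv; rewrite -lee_fin fineK //; apply: ereal_sup_ubound; exists v.
- move=> c xc; rewrite -lee_fin fineK //; apply: ge_ereal_sup => _ [v Kv <-].
  by rewrite lee_fin; exact: xc.
Qed.

Section strong_duality.
Context {R : realType} {X Y : hilbertType R}.
Variables (A : {linear X -> Y}) (b : Y) (K : set X) (eps : R).
Hypotheses (hA : bounded_operator A) (K_bounded : bounded_set K).
Hypotheses (K_closed : closed K) (K0 : K 0) (eps0 : 0 <= eps).
Hypothesis K_convex : convex_set (K : set (convex_lmodType X)).

(** Equals [r K] for [r > 0]; as a preimage it is visibly closed and convex. *)
Let dilate (r : R) := [set x | K (r^-1 *: x)].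
Let feasible (r : R) := dilate r `&` [set x | `|b - A x| <= eps].

Let A_cont : continuous A.
Proof. by have [M AM] := hA; exact: linear_norm_bound_continuous AM. Qed.

Let dilate_closed r : closed (dilate r).
Proof.
rewrite (_ : dilate r = ( *:%R r^-1) @^-1` K)//; apply: closed_comp => // x _.
exact: scaler_continuous.
Qed.

Let dilate_convex r : convex_set (dilate r : set (convex_lmodType X)).
Proof.
apply/convex_setP => x y t t01 Kx Ky; rewrite /dilate /= scalerDr !scalerA.
rewrite !(mulrC r^-1) -!scalerA.
by move/convex_setP: K_convex; apply.
Qed.

(** The origin belongs to [K] and [x / s] lies on the segment from 0 to
[x / r]. *)
Let dilate_mono r s : 0 < r -> r <= s -> dilate r `<=` dilate s.
Proof.
move=> r0 rs x Kx; rewrite /dilate /=.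
have s0 := lt_le_trans r0 rs.
have -> : s^-1 *: x = (r / s) *: (r^-1 *: x) + (1 - r / s) *: 0.
  by rewrite scaler0 addr0 scalerA mulrAC divff ?gt_eqF // mul1r.
move/convex_setP: K_convex; apply=> //.
by rewrite divr_ge0 ?(ltW r0) ?(ltW s0) //= ler_pdivrMr ?mul1r.
Qed.

Let dilate_bounded : exists M, forall r x, 0 < r -> dilate r x -> `|x| <= r * M.
Proof.
have [M M0 KM] := pinfty_ex_gt0 K_bounded; exists M => r x r0 /KM /=.
by rewrite normrZ gtr0_norm ?invr_gt0 // ler_pdivrMl.
Qed.

Let feasible_mono r s : 0 < r -> r <= s -> feasible r `<=` feasible s.
Proof. by move=> r0 rs x [Kx xe]; split => //; exact: dilate_mono Kx. Qed.

Lemma minkowski_gauge_ge0 x : (0 <= minkowski_gauge K x)%E.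
Proof. by apply: le_ereal_inf_tmp => _ [a [a0 _] <-]; rewrite lee_fin ltW. Qed.

Lemma primal_objective_ge0 x : (0 <= primal_objective A b K eps x)%E.
Proof.
apply: adde_ge0; last by rewrite /indicator; case: ifP; rewrite ?leey.
by apply: mule_ge0; [rewrite lee_fin|exact/expe_ge0/minkowski_gauge_ge0].
Qed.

Let primal_le r x : 0 < r -> feasible r x ->
  (primal_objective A b K eps x <= (r ^+ 2 / 2)%:E)%E.
Proof.
move=> r0 [Kx xe]; rewrite /primal_objective /indicator mem_set // adde0.
have jr : (minkowski_gauge K x <= r%:E)%E.
  apply: ereal_inf_lbound; exists r => //; split=> //; exists (r^-1 *: x) => //.
  by rewrite scalerA divff ?gt_eqF // scale1r.
rewrite mulrC EFinM EFin_expe; apply: lee_wpmul2l; first by rewrite lee_fin.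
by rewrite lee_sqr ?minkowski_gauge_ge0 // lee_fin ltW.
Qed.

(** The strict inequality provides some [a < r] with [x] in [a K], and [a K] is
contained in [r K]; it avoids showing that the gauge infimum is attained. *)
Let primal_lt r x : 0 < r ->
  (primal_objective A b K eps x < (r ^+ 2 / 2)%:E)%E -> feasible r x.
Proof.
move=> r0; rewrite /primal_objective /indicator.
have j0 := minkowski_gauge_ge0 x.
have t0 : (0 <= 2^-1%:E * minkowski_gauge K x ^+ 2)%E.
  by apply: mule_ge0; [rewrite lee_fin|exact: expe_ge0].
case: ifPn => [/set_mem xe|_]; last first.
  by rewrite addey ?ltNge ?leey // -ltNye (lt_le_trans _ t0).
rewrite adde0 => lt; split=> //.
have : (minkowski_gauge K x < r%:E)%E.
  rewrite ltNge; apply/negP => rj; move: lt; rewrite ltNge => /negP; apply.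
  rewrite mulrC EFinM EFin_expe; apply: lee_wpmul2l; first by rewrite lee_fin.
  by rewrite lee_sqr ?lee_fin ?(ltW r0).
move=> /ereal_inf_lt[_ [a [a0 [v Kv <-]] <-]]; rewrite lte_fin => ar.
apply: (dilate_mono a0 (ltW ar)).
by rewrite /dilate /= scalerA mulVf ?gt_eqF // scale1r.
Qed.

Let weak_duality r x y : 0 < r -> feasible r x ->
  (- dual_objective A b K eps y <= (r ^+ 2 / 2)%:E)%E.
Proof.
move=> r0 [Kx /= xe]; rewrite /dual_objective.
have [s [-> s0 sub _]] := support_functionP (adjoint A y) K_bounded K0.
rewrite -EFin_expe -EFinM -EFinB -EFinD -EFinN lee_fin.
have xs : inner (A x) y <= r * s.
  rewrite adjointP // innerC -ler_pdivrMl // -innerZr; exact: sub.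
have bAx : inner b y - inner (A x) y <= eps * `|y|.
  rewrite -innerNl -innerDl (le_trans (inner_le_norm _ _)) // ler_wpM2r //.
have := sqr_ge0 (r - s); rewrite sqrrB; lra.
Qed.

(** The residual [u] at the point of [r K] that [A] maps closest to [b]
separates the image of [r K] from the ball strictly, with margin [d]; a multiple
of [u] is the dual point sought. *)
Let dual_ascent r : 0 < r -> (forall x, ~ feasible r x) ->
  exists y, ((r ^+ 2 / 2)%:E <= - dual_objective A b K eps y)%E.
Proof.
move=> r0 infeasible.
have [M KM] := dilate_bounded.
have dilate0 : dilate r !=set0 by exists 0; rewrite /dilate /= scaler0.
have [|x Kx xmin] := @min_dist_attained _ _ _ A b (dilate r) A_cont
    (@dilate_convex r) (@dilate_closed r) dilate0.
  by move=> q; exists (r * M) => x Kx _; exact: KM.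
set u := b - A x in xmin.
have ue : eps < `|u| by rewrite ltNge; apply/negP => ue; apply: (infeasible x).
have [s [_ s0 sub slub]] := support_functionP (adjoint A u) K_bounded K0.
pose d := `|u| * (`|u| - eps).
have d0 : 0 < d by rewrite mulr_gt0 ?subr_gt0 // (le_lt_trans eps0).
have gap : r * s + d <= inner b u - eps * `|u|.
  have su : s <= r^-1 * inner (A x) u.
    apply: slub => v Kv; rewrite innerC -adjointP // ler_pdivlMl //.
    rewrite -innerZl -linearZ -subr_ge0 -oppr_le0 opprB -innerNl -innerDl.
    apply: (min_dist_obtuse (@dilate_convex r) Kx _ xmin).
    by rewrite /dilate /= scalerA mulVf ?gt_eqF // scale1r.
  rewrite ler_pdivlMl // in su.
  have : inner u u = inner b u - inner (A x) u by rewrite {1}/u innerDl innerNl.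
  by rewrite inner_normE /d => uu; lra.
(* Along the ray [t u], the value [- J] is at least this concave quadratic of
   [t]. For [s > 0] take [t = r / s], which maximises it up to the term [t d];
   for [s = 0] it is linear with slope [d] and reaches any level. *)
have [t t0 tP] : exists2 t, 0 < t &
    r ^+ 2 / 2 <= t * (r * s + d) - 2^-1 * (t * s) ^+ 2.
  have [s00|sN0] := eqVneq s 0.
    exists (r ^+ 2 / (2 * d)).
      by apply: divr_gt0; [exact: exprn_gt0|exact: mulr_gt0].
    rewrite s00 !mulr0 add0r expr0n mulr0 subr0 le_eqVlt.
    apply/orP; left; apply/eqP.
    by field; rewrite gt_eqF.
  have sp : 0 < s by rewrite lt_neqAle eq_sym sN0.
  have ts : r / s * s = r by rewrite divfK.
  have tp : 0 < r / s by rewrite divr_gt0.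
  exists (r / s) => //; rewrite ts mulrDr mulrCA ts.
  by have := mulr_gt0 tp d0; nra.
exists (t *: u); rewrite /dual_objective.
have [s' [-> s'0 _ s'lub]] :=
  support_functionP (adjoint A (t *: u)) K_bounded K0.
rewrite -EFin_expe -EFinM -EFinB -EFinD -EFinN lee_fin.
have s't : s' <= t * s.
  apply: s'lub => v Kv; rewrite innerC -adjointP // innerZr ler_pM2l //.
  by rewrite adjointP // innerC; exact: sub.
have sq : s' ^+ 2 <= (t * s) ^+ 2 by rewrite ler_sqr ?nnegrE ?mulr_ge0 // ltW.
rewrite innerZr normrZ (gtr0_norm t0).
apply: (le_trans tP).
have := ler_wpM2l (ltW t0) gap; nra.
Qed.

Let S := (- ereal_inf (range (dual_objective A b K eps)))%E.

Let dual_le_S y : (- dual_objective A b K eps y <= S)%E.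
Proof. by rewrite leeN2; apply: ereal_inf_lbound; exists y. Qed.

(** The radius whose half square is [c]: it indexes the dilates by objective
value. *)
Let rad (c : R) := Num.sqrt (2 * c).

Let rad_gt0 c : 0 < c -> 0 < rad c.
Proof. by move=> c0; rewrite sqrtr_gt0 mulr_gt0. Qed.

Let radE c : 0 < c -> rad c ^+ 2 / 2 = c.
Proof.
by move=> c0; rewrite sqr_sqrtr ?mulr_ge0 ?ltW // mulrAC divff ?mul1r.
Qed.

Let feasible_above c : 0 < c -> (S < c%:E)%E -> feasible (rad c) !=set0.
Proof.
move=> c0 Sc; apply: contrapT => nf.
have [|y] := @dual_ascent (rad c) (rad_gt0 c0).
  by move=> x fx; apply: nf; exists x.
rewrite radE // => cy; move: (le_lt_trans (le_trans cy (dual_le_S y)) Sc).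
by rewrite ltxx.
Qed.

Let S_ge0 : (0 <= S)%E.
Proof.
apply: le_trans (dual_le_S 0); rewrite /dual_objective.
have [s [-> s0 _ lub]] := support_functionP (adjoint A 0) K_bounded K0.
have -> : s = 0.
  apply/eqP; rewrite eq_le s0 andbT; apply: lub => v Kv.
  by rewrite innerC -adjointP // inner0r.
rewrite inner0r normr0 mulr0 -EFin_expe expr0n -EFinM -EFinB -EFinD -EFinN.
by rewrite lee_fin /= !mulr0 subr0 addr0 oppr0.
Qed.

Lemma strong_duality : primal_value A b K eps = S.
Proof.
apply/eqP; rewrite eq_le; apply/andP; split.
  have := S_ge0; case SE : S => [s| |] // s0; last by rewrite leey.
  rewrite lee_fin in s0; apply/lee_addgt0Pr => e e0.
  have se : 0 < s + e by rewrite ltr_wpDl.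
  have [|x fx] := feasible_above se; first by rewrite SE lte_fin ltrDl.
  rewrite -EFinD -(radE se); apply: le_trans (primal_le (rad_gt0 se) fx).
  by apply: ereal_inf_lbound; exists x.
apply: le_ereal_inf_tmp => _ [x _ <-]; rewrite leeNl.
apply: le_ereal_inf_tmp => _ [y _ <-]; rewrite leeNl.
rewrite leNgt; apply/negP => py.
(* A level [c] strictly between the two values would be both feasible, by
   [primal_lt], and excluded by [weak_duality]. *)
have : exists2 c, 0 < c & (primal_objective A b K eps x < c%:E
  < - dual_objective A b K eps y)%E.
  have p0 := primal_objective_ge0 x.
  move: py p0; case: (primal_objective _ _ _ _ _) => [p| |] //; last first.
    by rewrite ltNge leey.
  case: (- _)%E => [c| |] //.
    rewrite lte_fin lee_fin => pc p0; exists ((p + c) / 2); first by lra.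
    by rewrite !lte_fin; apply/andP; split; lra.
  move=> _; rewrite lee_fin => p0; exists (p + 1); first by lra.
  by rewrite ltry lte_fin andbT; lra.
move=> [c c0 /andP[pc cd]].
have := @weak_duality (rad c) x y (rad_gt0 c0).
rewrite radE // leNgt cd => /(_ _)/negP; apply => //.
by apply: primal_lt; [exact: rad_gt0|rewrite radE].
Qed.

(** The solutions are the common points of the feasible sets at the levels
[s + t], [t > 0], where [s] is the primal value; each of these sets is nonempty
because its level exceeds the dual value. *)
Lemma primal_attained : primal_value A b K eps \is a fin_num ->
  exists x, primal_objective A b K eps x = primal_value A b K eps.
Proof.
move=> /fineK; set s := fine _ => piE.
have SE : S = s%:E by rewrite -strong_duality.
have s0 : 0 <= s by rewrite -lee_fin -SE.
have st t : 0 < t -> 0 < s + t by move=> t0; rewrite ltr_wpDl.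
have [M KM] := dilate_bounded.
have [|||||x xE] := @nested_convex_nonempty _ _
  (fun t => feasible (rad (s + t))) (rad (s + 1) * M).
- by move=> t t0; exact: convex_sublevel.
- by move=> t t0; exact: closed_sublevel.
- by move=> t t0; apply: feasible_above; rewrite ?st // SE lte_fin ltrDl.
- move=> t t' t0 tt'; apply: feasible_mono; first exact/rad_gt0/st.
  by rewrite ler_wsqrtr // ler_pM2l // lerD2l.
- by move=> x [Kx _]; apply: KM => //; exact/rad_gt0/st.
exists x; apply/eqP; rewrite eq_le; apply/andP; split; last first.
  by apply: ereal_inf_lbound; exists x.
rewrite -piE; apply/lee_addgt0Pr => e e0.
rewrite -EFinD -(radE (st _ e0)); apply: primal_le; last exact: xE.
exact/rad_gt0/st.
Qed.

End strong_duality.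

Local Open Scope ereal_scope.

Theorem proposition2p1 (R : realType) (X Y : hilbertType R)
    (A : {linear X -> Y}) (hA : bounded_operator A) (b : Y)
    (K : set X) (K_bounded : bounded_set K) (K_closed : closed K)
    (K_convex : convex_set (K : set (convex_lmodType X))) (K0 : K 0%R) :
  forall eps : R, (0 <= eps)%R ->
    primal_value A b K eps = - ereal_inf (range (dual_objective A b K eps)) /\
    (primal_value A b K eps \is a fin_num ->
     exists x : X, primal_objective A b K eps x = primal_value A b K eps).
Proof.
by move=> eps eps0; split; [exact: strong_duality|exact: primal_attained].
Qed.
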